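(* Let $p\in(0,1]$. Suppose that $(\mathcal{M},d)$ is either (a) an infinite metric space, or (b) a uniformly separated uncountable $p$-metric space. Then there exists $\mathcal{N}\subset\mathcal{M}$ such that (i) $\mathcal{F}_{p}(\mathcal{N})\simeq\ell_{p}$, (ii) $L_{\jmath}\colon\mathcal{F}_{p}(\mathcal{N})\to\mathcal{F}_{p}(\mathcal{M})$ is an isomorphic embedding, where $\jmath\colon\mathcal{N}\to\mathcal{M}$ is the inclusion, and (iii) $L_{\jmath}(\mathcal{F}_{p}(\mathcal{N}))$ is complemented in $\mathcal{F}_{p}(\mathcal{M})$.
   Context: Let $0<p\le 1$. A $p$-metric on a set $\mathcal{M}$ is a symmetric map $d\colon\mathcal{M}\times\mathcal{M}\to[0,\infty)$ with $d(x,y)=0$ iff $x=y$ and $d^p(x,y)\le d^p(x,z)+d^p(z,y)$ for all $x,y,z$ (every metric is a $p$-metric). A $p$-Banach space is a complete real vector space with a $p$-norm, i.e. a quasi-norm with $\|x+y\|^p\le\|x\|^p+\|y\|^p$. For a $p$-metric space $\mathcal{M}$ with base point $0$, the Lipschitz free $p$-space $\mathcal{F}_p(\mathcal{M})$ is the $p$-Banach space, unique up to linear isometry, with an isometric embedding $\delta_{\mathcal{M}}\colon\mathcal{M}\to\mathcal{F}_p(\mathcal{M})$, $\delta_{\mathcal{M}}(0)=0$, such that for every $p$-Banach space $X$ and every Lipschitz map $f\colon\mathcal{M}\to X$ with $f(0)=0$ there is a unique bounded linear map $T_f\colon\mathcal{F}_p(\mathcal{M})\to X$ with $T_f\circ\delta_{\mathcal{M}}=f$,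 and $\|T_f\|=\mathrm{Lip}(f)$. The linear span of $\delta_{\mathcal{M}}(\mathcal{M})$ is dense in $\mathcal{F}_p(\mathcal{M})$. Changing the base point yields a linearly isometric space. For $\mathcal{N}\subset\mathcal{M}$ with inclusion $\jmath$ (the common base point being taken in $\mathcal{N}$), $L_\jmath\colon\mathcal{F}_p(\mathcal{N})\to\mathcal{F}_p(\mathcal{M})$ is the bounded linear map with $L_\jmath(\delta_{\mathcal{N}}(x))=\delta_{\mathcal{M}}(x)$ for $x\in\mathcal{N}$. $\mathcal{M}$ is uniformly separated if $\inf\{d(x,y)\colon x,y\in\mathcal{M},\,x\ne y\}>0$. $\simeq$ denotes linear isomorphism. A subspace is complemented if it is the range of a bounded linear projection. *)

(* Defs.v *)
From HB Require Import structures.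
From mathcomp Require Import all_boot all_order all_algebra.
From mathcomp Require Import all_classical all_reals all_analysis.

Set Implicit Arguments.
Unset Strict Implicit.
Unset Printing Implicit Defensive.

Import Order.TTheory GRing.Theory Num.Theory.
Import numFieldNormedType.Exports.

Local Open Scope classical_set_scope.
Local Open Scope ring_scope.

Record is_metric (R : realType) (M : Type) (d : M -> M -> R) : Prop := {
  is_metric_ge0 : forall x y, 0 <= d x y;
  is_metric_eq0 : forall x y, d x y = 0 <-> x = y;
  is_metric_sym : forall x y, d x y = d y x;
  is_metric_tri : forall x y z, d x y <= d x z + d z y }.

Record is_pmetric (R : realType) (p : R) (M : Type) (d : M -> M -> R)
    : Prop := {
  is_pmetric_ge0 : forall x y, 0 <= d x y;
  is_pmetric_eq0 : forall x y, d x y = 0 <-> x = y;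
  is_pmetric_sym : forall x y, d x y = d y x;
  is_pmetric_tri : forall x y z, d x y `^ p <= d x z `^ p + d z y `^ p }.

(* The infimum is taken in the extended reals, so that it is +oo when there is
   no pair of distinct points. *)
Definition uniformly_separated (R : realType) (M : Type) (d : M -> M -> R) :=
  (0 < ereal_inf [set r | exists x y, x <> y /\ r = (d x y)%:E])%E.

Definition subdist (R : realType) (M : Type) (d : M -> M -> R) (N : set M)
  (x y : N) : R := d (set_val x) (set_val y).

(* For 0 < p <= 1 the last clause implies the quasi-triangle inequality
   N (u + v) <= 2 `^ (p^-1 - 1) * (N u + N v), so that N is a quasi-norm. *)
Record is_pnorm (R : realType) (p : R) (V : lmodType R) (N : V -> R)
    : Prop := {
  is_pnorm_ge0 : forall v, 0 <= N v;
  is_pnorm_eq0 : forall v, N v = 0 -> v = 0;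
  is_pnormZ : forall a v, N (a *: v) = `|a| * N v;
  is_pnormD : forall u v, N (u + v) `^ p <= N u `^ p + N v `^ p }.

Definition pcomplete (R : realType) (V : lmodType R) (N : V -> R) :=
  forall u : nat -> V,
    (forall e, 0 < e -> exists n0, forall m n, (n0 <= m)%N -> (n0 <= n)%N ->
       N (u m - u n) < e) ->
    exists l, forall e, 0 < e -> exists n0, forall n, (n0 <= n)%N ->
       N (u n - l) < e.

Record pBanach (R : realType) (p : R) := PBanach {
  pBanach_sort :> lmodType R;
  pnorm : pBanach_sort -> R;
  pnormP : is_pnorm p pnorm;
  pnorm_complete : pcomplete pnorm }.

Section Operators.
Context (R : realType) (p : R).
Implicit Types X Y : pBanach p.

Definition bounded_op X Y (T : X -> Y) :=
  exists C, forall v, pnorm (T v) <= C * pnorm v.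

(* [sup] is 0 on sets without a supremum; here and in [lip_const] the set is
   bounded when T is bounded, resp. f is Lipschitz, and [lip_const f] = 0 on a
   one-point space. *)
Definition op_norm X Y (T : X -> Y) : R :=
  sup [set pnorm (T v) | v in [set v | pnorm v <= 1]].

Definition isomorphic X Y :=
  exists (T : {linear X -> Y}) (S : {linear Y -> X}),
    [/\ bounded_op T, bounded_op S, cancel T S & cancel S T].

(* The last clause is boundedness of the inverse of T on its range. *)
Definition isomorphic_embedding X Y (T : {linear X -> Y}) :=
  [/\ bounded_op T, injective T & exists C, forall v, pnorm v <= C * pnorm (T v)].

Definition complemented X (W : set X) :=
  exists P : {linear X -> X},
    [/\ bounded_op P, (forall v, P (P v) = P v) & range P = W].

End Operators.

Section LipschitzMaps.
Context (R : realType) (p : R) (M : Type) (d : M -> M -> R) (X : pBanach p).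

Definition lipschitz (f : M -> X) :=
  exists C, forall x y, pnorm (f x - f y) <= C * d x y.

Definition lip_const (f : M -> X) : R :=
  sup [set r | exists x y, x <> y /\ r = pnorm (f x - f y) / d x y].

End LipschitzMaps.

(* A model of F_p(M, d) with base point o, given by its universal property; it
   is determined up to a linear isometry intertwining the maps [delta]. *)
Record free_pspace (R : realType) (p : R) (M : Type) (d : M -> M -> R) (o : M)
    := FreePSpace {
  free_sort :> pBanach p;
  delta : M -> free_sort;
  delta_base : delta o = 0;
  delta_isometric : forall x y, pnorm (delta x - delta y) = d x y;
  free_ext_ax : forall (X : pBanach p) (f : M -> X),
    lipschitz d f -> f o = 0 ->
    exists T : {linear free_sort -> X},
      [/\ bounded_op T, (forall x, T (delta x) = f x),
          op_norm T = lip_const d f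
        & forall T' : {linear free_sort -> X}, bounded_op T' ->
            (forall x, T' (delta x) = f x) -> T' =1 T] }.

Section FreeExtension.
Context (R : realType) (p : R) (M : Type) (d : M -> M -> R) (o : M).
Context (F : free_pspace p d o) (X : pBanach p) (f : M -> X).
Hypotheses (f_lip : lipschitz d f) (fo : f o = 0).

Definition free_ext : {linear F -> X} := sval (cid (free_ext_ax F f_lip fo)).

Lemma free_ext_bounded : bounded_op free_ext.
Proof. by rewrite /free_ext; case: cid => T []. Qed.

Lemma free_extE x : free_ext (delta F x) = f x.
Proof. by rewrite /free_ext; case: cid => T []. Qed.

Lemma free_ext_norm : op_norm free_ext = lip_const d f.
Proof. by rewrite /free_ext; case: cid => T []. Qed.

Lemma free_ext_unique (T : {linear F -> X}) :
  bounded_op T -> (forall x, T (delta F x) = f x) -> T =1 free_ext.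
Proof. by rewrite /free_ext; case: cid => T' [] ? ? ? /= h; exact: h. Qed.

End FreeExtension.

Section Inclusion.
Context (R : realType) (p : R) (M : Type) (d : M -> M -> R) (N : set M) (o : N).
Context (FN : free_pspace p (@subdist _ _ d N) o).
Context (FM : free_pspace p d (set_val o)).

Lemma incl_lipschitz :
  lipschitz (@subdist _ _ d N) (fun x : N => delta FM (set_val x)).
Proof. by exists 1 => x y; rewrite mul1r delta_isometric. Qed.

Lemma incl_base : delta FM (set_val o) = 0.
Proof. exact: delta_base. Qed.

(* The canonical map L_j from F_p(N) to F_p(M) induced by the inclusion j. *)
Definition free_incl : {linear FN -> FM} := free_ext FN incl_lipschitz incl_base.

Lemma free_incl_bounded : bounded_op free_incl.
Proof. exact: free_ext_bounded. Qed.

Lemma free_inclE x : free_incl (delta FN x) = delta FM (set_val x).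
Proof. exact: free_extE. Qed.

End Inclusion.

Lemma ler_powRl (R : realType) (r a b : R) :
  0 <= r -> 0 <= a -> a <= b -> a `^ r <= b `^ r.
Proof.
move=> r0 a0 ab; have b0 := le_trans a0 ab.
by apply: ge0_ler_powR; rewrite ?nnegrE.
Qed.

Section PowerSubadditivity.
Context (R : realType) (p : R) (hp : 0 < p <= 1).

Lemma powRD_le (a b : R) : 0 <= a -> 0 <= b -> (a + b) `^ p <= a `^ p + b `^ p.
Proof.
have [p0 p1] := andP hp.
move=> a0 b0; have [s0|] := ltP 0 (a + b); last first.
  move=> s0; have -> : a + b = 0 by apply/eqP; rewrite eq_le s0 addr_ge0.
  by rewrite powR0 ?gt_eqF//; apply: addr_ge0; exact: powR_ge0.
have key c : 0 <= c -> c <= a + b -> c / (a + b) * (a + b) `^ p <= c `^ p.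
  move=> c0 cs; have [->|cn0] := eqVneq c 0; first by rewrite !mul0r powR_ge0.
  have c_gt0 : 0 < c by rewrite lt_neqAle eq_sym cn0.
  have : c / (a + b) <= (c / (a + b)) `^ p.
    by rewrite ger1_powR// divr_gt0//= ler_pdivrMr// mul1r.
  move=> /(ler_wpM2r (powR_ge0 (a + b) p)) /le_trans; apply.
  by rewrite -powRM ?divr_ge0 ?(ltW s0)// divfK// gt_eqF.
have -> : (a + b) `^ p = a / (a + b) * (a + b) `^ p + b / (a + b) * (a + b) `^ p.
  by rewrite -mulrDl -mulrDl divff ?mul1r// gt_eqF.
by rewrite lerD// key// ?lerDl// lerDr.
Qed.

Lemma normD_powR_le (a b : R) : `|a + b| `^ p <= `|a| `^ p + `|b| `^ p.
Proof.
apply: le_trans (powRD_le (normr_ge0 _) (normr_ge0 _)).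
have [p0 _] := andP hp.
by apply: ler_powRl; rewrite ?normr_ge0 ?ler_normD// ltW.
Qed.

End PowerSubadditivity.

Section SequenceSpace.
Context (R : realType) (p : R) (hp : 0 < p <= 1).
Implicit Types u v : nat -> R^o.

Definition lp_series u : nat -> R := series (fun n => `|u n| `^ p).

(* The proof [hp] occurs in the predicate only so that the closure properties
   below can be inferred from it. *)
Definition summable_p of 0 < p <= 1 : {pred (nat -> R^o)} :=
  fun u => `[< cvgn (lp_series u) >].

Definition lp_norm_seq u : R := (limn (lp_series u)) `^ p^-1.

Let p_gt0 : 0 < p. Proof. by case/andP: hp. Qed.
Let p_neq0 : p != 0. Proof. by rewrite gt_eqF. Qed.

Lemma lp_series_nd u : nondecreasing_seq (lp_series u).
Proof. by apply: nondecreasing_series => n _ _; exact: powR_ge0. Qed.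

Lemma lp_series_ge0 u n : 0 <= lp_series u n.
Proof. by rewrite /lp_series /series/= sumr_ge0// => i _; exact: powR_ge0. Qed.

Lemma lp_series_cvg u C : (forall n, lp_series u n <= C) -> cvgn (lp_series u).
Proof.
move=> uC; apply: nondecreasing_is_cvgn; first exact: lp_series_nd.
by exists C => _ [n _ <-].
Qed.

Lemma lp_lim_le u C : (forall n, lp_series u n <= C) -> limn (lp_series u) <= C.
Proof.
by move=> uC; apply: limr_le; [exact: lp_series_cvg uC|exact: nearW].
Qed.

Lemma lp_series_le u n : u \in summable_p hp -> lp_series u n <= limn (lp_series u).
Proof.
move=> /asboolP cu; apply: nondecreasing_cvgn_le cu n; exact: lp_series_nd.
Qed.

Lemma lp_lim_ge0 u : u \in summable_p hp -> 0 <= limn (lp_series u).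
Proof. by move=> /(lp_series_le 0%N); apply: le_trans (lp_series_ge0 _ _). Qed.

Lemma lp_seriesD u v n :
  lp_series (u + v) n <= lp_series u n + lp_series v n.
Proof.
rewrite /lp_series /series/= -big_split/=; apply: ler_sum => i _.
exact: normD_powR_le.
Qed.

Lemma lp_seriesZ a u n : lp_series (a *: u) n = `|a| `^ p * lp_series u n.
Proof.
rewrite /lp_series /series/= mulr_sumr; apply: eq_bigr => i _.
by rewrite -powRM ?normr_ge0// -normrM.
Qed.

Lemma lp_seriesD_le u v n : u \in summable_p hp -> v \in summable_p hp ->
  lp_series (u + v) n <= limn (lp_series u) + limn (lp_series v).
Proof.
by move=> su sv; apply: (le_trans (lp_seriesD _ _ _)); rewrite lerD ?lp_series_le.
Qed.

Lemma lp_seriesZ_le a u n : u \in summable_p hp ->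
  lp_series (a *: u) n <= `|a| `^ p * limn (lp_series u).
Proof. by move=> su; rewrite lp_seriesZ ler_wpM2l ?powR_ge0 ?lp_series_le. Qed.

Lemma summable_p_submod_closed : submod_closed (summable_p hp).
Proof.
have sZ a u : u \in summable_p hp -> a *: u \in summable_p hp.
  move=> su; apply/asboolP; apply: lp_series_cvg => n; exact: lp_seriesZ_le.
split; last first.
  move=> a u v /(sZ a) su sv; apply/asboolP; apply: lp_series_cvg => n.
  exact: lp_seriesD_le.
apply/asboolP; apply: (@lp_series_cvg _ 0) => n.
rewrite /lp_series /series/= big1// => i _.
by rewrite normr0 powR0.
Qed.

HB.instance Definition _ :=
  GRing.isSubmodClosed.Build R (nat -> R^o) (summable_p hp)
    summable_p_submod_closed.

Record lp_seq := LpSeq { lp_val : nat -> R^o; _ : lp_val \in summable_p hp }.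

HB.instance Definition _ := [isSub for lp_val].
HB.instance Definition _ := [Choice of lp_seq by <:].
HB.instance Definition _ := [SubChoice_isSubLmodule of lp_seq by <:].

Definition lp_norm (u : lp_seq) : R := lp_norm_seq (lp_val u).

Let lp_valP (u : lp_seq) : lp_val u \in summable_p hp. Proof. exact: valP. Qed.

Lemma lp_norm_ge0 (u : lp_seq) : 0 <= lp_norm u.
Proof. exact: powR_ge0. Qed.

Lemma lp_norm_powR (u : lp_seq) : lp_norm u `^ p = limn (lp_series (lp_val u)).
Proof. by rewrite -powRrM mulVf// powRr1// lp_lim_ge0. Qed.

Lemma lp_norm_le (u : lp_seq) C : 0 <= C ->
  (forall n, lp_series (lp_val u) n <= C `^ p) -> lp_norm u <= C.
Proof.
move=> C0 uC; rewrite -[leRHS]powRr1// -(mulfV p_neq0) powRrM.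
by apply: ler_powRl; rewrite ?lp_lim_ge0 ?lp_lim_le// invr_ge0 ltW.
Qed.

Lemma lp_coord_le (u : lp_seq) n : `|lp_val u n| <= lp_norm u.
Proof.
have h : `|lp_val u n| `^ p <= limn (lp_series (lp_val u)).
  apply: le_trans (lp_series_le n.+1 (lp_valP u)).
  by rewrite /lp_series /series/= big_nat_recr//= lerDr sumr_ge0.
rewrite -[leLHS]powRr1// -(mulfV p_neq0) powRrM.
by apply: ler_powRl; rewrite ?powR_ge0// invr_ge0 ltW.
Qed.

Lemma lp_norm_is_pnorm : is_pnorm p lp_norm.
Proof.
have nZ a (u : lp_seq) : lp_norm (a *: u) <= `|a| * lp_norm u.
  apply: lp_norm_le; first by rewrite mulr_ge0 ?lp_norm_ge0.
  move=> n; rewrite powRM ?lp_norm_ge0// lp_norm_powR.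
  exact: lp_seriesZ_le.
split.
- exact: lp_norm_ge0.
- move=> u u0; apply/val_inj/funext => n.
  by apply/eqP; rewrite -normr_le0 -u0; exact: lp_coord_le.
- move=> a u; apply/eqP; rewrite eq_le nZ/=.
  have [->|a0] := eqVneq a 0; first by rewrite normr0 mul0r lp_norm_ge0.
  rewrite -{1}[u]scale1r -(mulVf a0) -scalerA -ler_pdivlMl ?normr_gt0//.
  by rewrite -normfV.
- move=> u v; rewrite [leLHS]lp_norm_powR [X in _ <= X + _]lp_norm_powR.
  rewrite [X in _ <= _ + X]lp_norm_powR; apply: lp_lim_le => n.
  exact: (lp_seriesD_le n (lp_valP u) (lp_valP v)).
Qed.

Lemma lp_norm_complete : pcomplete lp_norm.
Proof.
move=> u cu.
have cvgu n : cvgn (fun k => lp_val (u k) n : R).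
  apply: cauchy_cvg; apply: cauchy_exP => e e0.
  have [k0 hk] := cu _ e0; exists (lp_val (u k0) n : R), k0 => // k /= k0k.
  apply: le_lt_trans (hk k0 k (leqnn _) k0k).
  exact: (lp_coord_le (u k0 - u k)).
pose l : nat -> R^o := fun n => limn (fun k => lp_val (u k) n : R).
have ul n e : 0 < e -> \forall k \near \oo, `|lp_val (u k) n - l n| < e.
  move=> e0; have /cvgrPdist_lt /(_ e e0) := cvgu n.
  by apply: filterS => k; rewrite distrC.
have main e : 0 < e -> exists k0, forall k, (k0 <= k)%N -> forall m,
    lp_series (lp_val (u k) - l) m <= e `^ p.
  move=> e0; pose c := 2 `^ p^-1 : R.
  have c0 : 0 < c by rewrite powR_gt0.
  have e'0 : 0 < e / c by rewrite divr_gt0.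
  have e'p : (e / c) `^ p + (e / c) `^ p = e `^ p.
    have cp : c `^ p = 2 by rewrite /c -powRrM mulVf// powRr1.
    have -> : e `^ p = (e / c) `^ p * 2.
      by rewrite -[in RHS]cp -powRM ?divfK ?gt_eqF// ltW.
    by rewrite mulr_natr mulr2n.
  have [k0 hk] := cu _ e'0; exists k0 => k k0k m.
  pose t := (e / c) `^ p / m.+1%:R.
  have t0 : 0 < t by rewrite divr_gt0 ?powR_gt0.
  have : \forall j \near \oo, (k0 <= j)%N /\
      forall i : 'I_m, `|lp_val (u j) i - l i| < t `^ p^-1.
    apply: filterI; first exact: nbhs_infty_ge.
    apply: (@filter_forall _ _
      (fun (i : 'I_m) j => `|lp_val (u j) i - l i| < t `^ p^-1) \oo _) => i.
    by apply: ul; rewrite powR_gt0.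
  move=> /filter_ex[j [k0j hj]].
  have -> : lp_val (u k) - l = lp_val (u k - u j) + (lp_val (u j) - l).
    by rewrite /= addrA subrK.
  apply: (le_trans (lp_seriesD _ _ _)); rewrite -e'p; apply: lerD.
    apply: (le_trans (lp_series_le _ (lp_valP _))); rewrite -lp_norm_powR.
    by apply: ler_powRl; [exact: ltW|exact: powR_ge0|apply: ltW; exact: hk].
  rewrite /lp_series /series/= big_mkord.
  apply: (@le_trans _ _ (\sum_(i < m) t)).
    apply: ler_sum => i _.
    have tp : (t `^ p^-1) `^ p = t by rewrite -powRrM mulVf// powRr1// ltW.
    by rewrite -[leRHS]tp; apply: ler_powRl; [exact: ltW|exact: normr_ge0|apply: ltW; exact: hj].
  rewrite sumr_const card_ord -mulr_natr.
  have : t * m%:R <= t * m.+1%:R by rewrite ler_wpM2l ?ltW// ltr_nat.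
  by rewrite /t divfK// pnatr_eq0.
have sl : l \in summable_p hp.
  have [k0 /(_ k0 (leqnn _)) h] := main 1 ltr01.
  have sul : lp_val (u k0) - l \in summable_p hp.
    by apply/asboolP; exact: lp_series_cvg h.
  by rewrite -[l](subKr (lp_val (u k0))) rpredB.
exists (LpSeq sl) => e e0.
have [k0 hk] := main _ (divr_gt0 e0 (ltr0n _ 2)).
exists k0 => k k0k; apply: (@le_lt_trans _ _ (e / 2)); last first.
  by rewrite ltr_pdivrMr// ltr_pMr// ltr1n.
by apply: lp_norm_le; [rewrite divr_ge0// ltW|exact: hk].
Qed.

Definition ell_p : pBanach p := PBanach lp_norm_is_pnorm lp_norm_complete.

End SequenceSpace.

(* Main.v *)
Require Import Defs.
From HB Require Import structures.
From mathcomp Require Import all_boot all_order all_algebra.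
From mathcomp Require Import all_classical all_reals all_analysis.
From mathcomp Require Import ring lra.

Set Implicit Arguments.
Unset Strict Implicit.
Unset Printing Implicit Defensive.

Import Order.TTheory GRing.Theory Num.Theory.
Import numFieldNormedType.Exports.

Local Open Scope classical_set_scope.
Local Open Scope ring_scope.

(** Consider points [x n] of M around a centre, at distances comparable to
    [w n > 0], and assume that the [x n] carry bumps [phi n] on M: uniformly
    Lipschitz functions with disjoint supports such that [phi n (x n) = w n].
    Let N consist of the [x n], together with the centre if it is chosen in M.

    - The map [f y = (phi n y)_n] from M to l_p is Lipschitz: a difference
      [f y - f z] has at most two nonzero coordinates.  Hence it extends to a
      bounded operator T from F_p(M) to l_p.
    - The vectors [v n = (delta (x n) - delta (centre)) / w n] of F_p(N) are
      bounded, so p-subadditivity and completeness give a bounded operator S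
      from l_p to F_p(N) that maps the unit vectors to the [v n].

    Since [f (x n)] is [w n] times a unit vector and f vanishes at the centre,
    T J and S are inverse to each other, where J is the canonical map from
    F_p(N) to F_p(M).  Therefore F_p(N) is isomorphic to l_p, J is an embedding
    and J S T is a projection onto its range ([star_complemented]).

    The centre need not be a point of M: all that is used is a Cauchy sequence
    [c] of points of N, whose images in F_p(N) converge.  This is what makes the
    argument work in incomplete spaces such as {1/n}.

    It remains to find such a star.  In a metric space the bumps are the
    truncated cones [max(0, w n - d(x n, .))], and they have disjoint supports
    as soon as [w m + w n <= d(x m, x n)].  If every infinite subset of M has
    infinite subsets of arbitrarily small diameter, a nested choice of subsets
    gives a rapidly Cauchy sequence, which serves as its own centre
    ([shrinking_lp]).  Otherwise some infinite set A meets every ball of some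
    radius in a finite set, and any point can serve as the centre: if a large
    ball contains infinitely many points of A, one takes separated points in it
    with a constant w; if not, points going to infinity fast, with w
    proportional to the distance to the centre ([metric_lp]).  In a uniformly
    separated space the indicator function of a point is Lipschitz and takes the
    place of the cone, which need not be Lipschitz for a p-metric;
    uncountability provides a ball with infinitely many points
    ([separated_lp]). *)

(** * Convergence in p-Banach spaces *)

Section PNorm.
Context (R : realType) (p : R) (hp : 0 < p <= 1).
Implicit Types X Y Z : pBanach p.

Let p_gt0 : 0 < p. Proof. by case/andP: hp. Qed.
Let p_neq0 : p != 0. Proof. by rewrite gt_eqF. Qed.

Lemma powRVK (a : R) : 0 <= a -> (a `^ p^-1) `^ p = a.
Proof. by move=> a0; rewrite -powRrM mulVf// powRr1. Qed.

Lemma powR_le_root (a b : R) : 0 <= a -> a `^ p <= b -> a <= b `^ p^-1.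
Proof.
move=> a0 ab; rewrite -[leLHS]powRr1// -(mulfV p_neq0) powRrM.
by apply: ler_powRl; rewrite ?powR_ge0// invr_ge0 ltW.
Qed.

Lemma pnorm_ge0 X (v : X) : 0 <= pnorm v.
Proof. exact: is_pnorm_ge0 (pnormP X) v. Qed.

Lemma pnormZ X a (v : X) : pnorm (a *: v) = `|a| * pnorm v.
Proof. exact: is_pnormZ (pnormP X) a v. Qed.

Lemma pnorm0 X : pnorm (0 : X) = 0.
Proof. by rewrite -(scale0r (0 : X)) pnormZ normr0 mul0r. Qed.

Lemma pnormN X (v : X) : pnorm (- v) = pnorm v.
Proof. by rewrite -scaleN1r pnormZ normrN1 mul1r. Qed.

Lemma pnormD X (u v : X) : pnorm (u + v) `^ p <= pnorm u `^ p + pnorm v `^ p.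
Proof. exact: is_pnormD (pnormP X) u v. Qed.

Lemma pnormB X (u v w : X) :
  pnorm (u - v) `^ p <= pnorm (u - w) `^ p + pnorm (v - w) `^ p.
Proof.
rewrite -[X in _ <= _ + X `^ _]pnormN opprB; apply: le_trans (pnormD _ _).
by rewrite addrA subrK.
Qed.

Lemma pnormZp X a (v : X) : pnorm (a *: v) `^ p = `|a| `^ p * pnorm v `^ p.
Proof. by rewrite pnormZ powRM// pnorm_ge0. Qed.

Lemma pnorm_sum X (I : Type) (r : seq I) (P : pred I) (v : I -> X) :
  pnorm (\sum_(i <- r | P i) v i) `^ p <= \sum_(i <- r | P i) pnorm (v i) `^ p.
Proof.
apply: (big_ind2 (fun (a : X) (b : R) => pnorm a `^ p <= b)) => //.
- by rewrite pnorm0 powR0.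
- move=> a a' b b' h h'; apply: le_trans (pnormD _ _) _; exact: lerD.
Qed.

Lemma pnorm_powR_eq0 X (v : X) : pnorm v `^ p <= 0 -> v = 0.
Proof.
move=> h; apply: (is_pnorm_eq0 (pnormP X)); apply: (@powR_eq0_eq0 _ _ p).
by apply/eqP; rewrite eq_le h powR_ge0.
Qed.

Lemma bounded_opP X Y (T : X -> Y) :
  bounded_op T <-> exists B, forall v, pnorm (T v) `^ p <= B * pnorm v `^ p.
Proof.
split=> [[C TC]|[B TB]].
  exists (Num.max C 0 `^ p) => v.
  rewrite -powRM ?le_max ?lexx ?orbT ?pnorm_ge0//.
  apply: ler_powRl; [exact: ltW|exact: pnorm_ge0|].
  by apply: le_trans (TC v) _; rewrite ler_wpM2r ?pnorm_ge0// le_max lexx.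
exists (Num.max B 0 `^ p^-1) => v.
have m0 : 0 <= Num.max B 0 by rewrite le_max lexx orbT.
have : pnorm (T v) <= (Num.max B 0 * pnorm v `^ p) `^ p^-1.
  apply: powR_le_root; first exact: pnorm_ge0.
  by apply: le_trans (TB v) _; rewrite ler_wpM2r ?powR_ge0// le_max lexx.
by rewrite powRM ?powR_ge0// -powRrM mulfV// powRr1// pnorm_ge0.
Qed.

Lemma bounded_op_comp X Y Z (S : Y -> Z) (T : X -> Y) :
  bounded_op S -> bounded_op T -> bounded_op (S \o T).
Proof.
move=> [C SC] [D TD]; exists (Num.max C 0 * D) => v /=.
apply: le_trans (SC _) _; rewrite -mulrA.
have m0 : 0 <= Num.max C 0 by rewrite le_max lexx orbT.
apply: le_trans (_ : Num.max C 0 * pnorm (T v) <= _).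
  by rewrite ler_wpM2r ?pnorm_ge0// le_max lexx.
by rewrite ler_wpM2l.
Qed.

(** Stated with p-th powers, for which the triangle inequality holds without a
    constant. *)
Definition pcvg X (u : nat -> X) (l : X) : Prop :=
  (fun n => pnorm (u n - l) `^ p) @ \oo --> (0 : R).

Lemma squeeze0 (a b : nat -> R) : (forall n, 0 <= a n <= b n) ->
  b @ \oo --> (0 : R) -> a @ \oo --> (0 : R).
Proof.
move=> ab b0; apply: squeeze_cvgr (cvg_cst 0) b0; exact: nearW.
Qed.

Lemma cvg0D (a b : nat -> R) (l : R) : a @ \oo --> (0 : R) -> b @ \oo --> l ->
  (fun n => a n + b n) @ \oo --> l.
Proof. by move=> a0 bl; rewrite -[l]add0r; exact: cvgD. Qed.

Lemma cvg0Mr k (a : nat -> R) : a @ \oo --> (0 : R) ->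
  (fun n => k * a n) @ \oo --> (0 : R).
Proof. by move=> a0; rewrite -(mulr0 k); exact: cvgMr. Qed.

Lemma pcvg_unique X (u : nat -> X) l l' : pcvg u l -> pcvg u l' -> l = l'.
Proof.
move=> ul ul'; apply/eqP; rewrite -subr_eq0; apply/eqP/pnorm_powR_eq0.
have h := cvg0D ul ul'.
apply: (cvgr_to_ge h); apply: nearW => n.
rewrite -(pnormN (u n - l)) -(pnormN (u n - l')) !opprB; exact: pnormB.
Qed.

Lemma pcvgD X (u u' : nat -> X) l l' :
  pcvg u l -> pcvg u' l' -> pcvg (fun n => u n + u' n) (l + l').
Proof.
move=> ul ul'; have := cvg0D ul ul'; apply: squeeze0 => n /=.
by rewrite powR_ge0 opprD addrACA pnormD.
Qed.

Lemma pcvgZ X a (u : nat -> X) l :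
  pcvg u l -> pcvg (fun n => a *: u n) (a *: l).
Proof.
move=> ul; have := cvg0Mr (`|a| `^ p) ul; apply: squeeze0 => n /=.
by rewrite powR_ge0 -scalerBr pnormZp lexx.
Qed.

Lemma pcvg_near X (u : nat -> X) l n0 :
  (forall n, (n0 <= n)%N -> u n = l) -> pcvg u l.
Proof.
move=> ul; apply: cvg_near_cst; exists n0 => // n /= /ul ->.
by rewrite subrr pnorm0 powR0.
Qed.

Lemma pcvg_op X Y (T : {linear X -> Y}) (u : nat -> X) l :
  bounded_op T -> pcvg u l -> pcvg (fun n => T (u n)) (T l).
Proof.
move=> /bounded_opP[B TB] ul.
have := cvg0Mr B ul; apply: squeeze0 => n /=.
by rewrite powR_ge0 -linearB TB.
Qed.

Lemma pcvg_le X (u : nat -> X) l (b : R) n0 : pcvg u l ->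
  (forall n, (n0 <= n)%N -> pnorm (u n) `^ p <= b) -> pnorm l `^ p <= b.
Proof.
move=> ul ub; have bb : (fun _ : nat => b) @ \oo --> b by exact: cvg_cst.
have h := cvg0D ul bb.
apply: (cvgr_to_ge h); exists n0 => // n /= n0n.
apply: le_trans (_ : pnorm (u n - l) `^ p + pnorm (u n) `^ p <= _); last first.
  by rewrite lerD2l ub.
rewrite -(pnormN (u n - l)) opprB; apply: le_trans (pnormD _ _).
by rewrite subrK.
Qed.

Lemma pcauchy_cvg X (u : nat -> X) :
  (forall e, 0 < e -> exists n0, forall m n, (n0 <= m <= n)%N ->
     pnorm (u n - u m) `^ p < e) ->
  exists l, pcvg u l.
Proof.
move=> cu; have [|l ul] := @pnorm_complete _ _ X u.
  move=> e e0; have [n0 hn0] := cu _ (powR_gt0 p e0); exists n0 => m n.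
  wlog mn : m n / (m <= n)%N => [wl n0m n0n|n0m _].
    have [mn|/ltnW nm] := leqP m n; first exact: wl.
    by rewrite -opprB pnormN; exact: wl.
  rewrite -opprB pnormN ltNge; apply/negP => h.
  have := hn0 m n; rewrite n0m mn => /(_ isT); apply/negP; rewrite -leNgt.
  by apply: ler_powRl h; exact: ltW.
exists l; apply/cvgrPdist_lt => e e0.
have [|n0 hn0] := ul (e `^ p^-1); first exact: powR_gt0.
exists n0 => // n /= n0n; rewrite sub0r normrN ger0_norm ?powR_ge0//.
rewrite -[ltRHS](powRVK (ltW e0)).
by apply: gt0_ltr_powR; rewrite ?nnegrE ?pnorm_ge0 ?powR_ge0 ?hn0.
Qed.

End PNorm.

(** * Operators and Lipschitz maps into and out of l_p *)

Section SequenceSpaceOperators.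
Context (R : realType) (p : R) (hp : 0 < p <= 1).
Implicit Types (X : pBanach p) (u : ell_p hp).

Let p_gt0 : 0 < p. Proof. by case/andP: hp. Qed.

(** The universal property of l_p among p-Banach spaces: a bounded sequence [v]
    is the image of the unit vectors under a bounded operator.  The tails of
    [\sum_i u i *: v i] are dominated by those of the series of the
    [`|u i| `^ p]. *)
Lemma lp_operator X (v : nat -> X) (B : R) :
  (forall i, pnorm (v i) `^ p <= B) ->
  exists2 S : {linear ell_p hp -> X}, bounded_op S &
    forall u, pcvg (fun n => \sum_(i < n) (lp_val u i : R) *: v i) (S u).
Proof.
move=> vB; pose s u n := \sum_(i < n) (lp_val u i : R) *: v i.
have B0 : 0 <= B by apply: le_trans (vB 0%N); exact: powR_ge0.
have sB u m n : (m <= n)%N -> pnorm (s u n - s u m) `^ p <=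
    B * (lp_series p (lp_val u) n - lp_series p (lp_val u) m).
  move=> mn; rewrite /s /lp_series sub_series_geq//.
  rewrite -!(big_mkord xpredT (fun i => (lp_val u i : R) *: v i)).
  rewrite (big_cat_nat (leq0n m) mn)/= addrAC subrr add0r.
  apply: le_trans (pnorm_sum hp _ _ _) _; rewrite mulr_sumr.
  apply: ler_sum => i _; rewrite pnormZp// mulrC.
  by rewrite ler_wpM2r ?powR_ge0.
have cs u : exists l, pcvg (s u) l.
  apply: (pcauchy_cvg hp) => e e0.
  have su : lp_val u \in summable_p hp by exact: valP.
  have cu : cvgn (lp_series p (lp_val u)) by apply/asboolP.
  have e'0 : 0 < e / (B + 1) by rewrite divr_gt0// ltr_wpDl.
  have /cvgrPdist_lt/(_ _ e'0)[n0 _ hn0] := cu.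
  exists n0 => m n /andP[n0m mn]; apply: le_lt_trans (sB u m n mn) _.
  apply: (@le_lt_trans _ _ (B * (e / (B + 1)))); last first.
    rewrite mulrCA -ltr_pdivlMl// mulVf ?gt_eqF//.
    by rewrite ltr_pdivrMr ?ltr_wpDl// mul1r ltrDl.
  rewrite ler_wpM2l//; apply: le_trans (ltW (hn0 m n0m)).
  by apply: le_trans (ler_norm _); rewrite lerB// lp_series_le.
have [S hS] := choice cs.
have linS : linear S.
  move=> a u u'; apply: (pcvg_unique (hS _)).
  have h := pcvgD (pcvgZ a (hS u)) (hS u').
  apply: cvg_trans h; apply: near_eq_cvg; apply: nearW => n /=.
  congr (pnorm (_ - _) `^ p); rewrite /s scaler_sumr -big_split/=.
  by apply: eq_bigr => i _; rewrite scalerDl scalerA.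
pose Sl : {linear ell_p hp -> X} :=
  HB.pack S (GRing.isLinear.Build _ _ _ _ S linS).
exists Sl; last exact: hS.
apply/(bounded_opP hp); exists B => u /=.
apply: (pcvg_le (n0 := 0%N) (hS u)) => n _.
have := sB u 0%N n (leq0n _).
rewrite {2}/s big_ord0 subr0 => /le_trans; apply.
apply: ler_wpM2l => //; rewrite [leRHS]lp_norm_powR.
have -> : lp_series p (lp_val u) 0%N = 0.
  by rewrite /lp_series /series/= big_geq.
by rewrite subr0 lp_series_le//; exact: valP.
Qed.

(** Coordinates identify limits in l_p; this avoids the density of finitely
    supported sequences when checking that an operator of l_p is the
    identity. *)
Lemma pcvg_coord (u : nat -> ell_p hp) (l : ell_p hp) m (a : R) n0 :
  pcvg u l -> (forall k, (n0 <= k)%N -> lp_val (u k) m = a) -> lp_val l m = a.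
Proof.
move=> ul um; apply/esym/eqP; rewrite -subr_eq0 -normr_eq0; apply/eqP.
apply: (@powR_eq0_eq0 _ _ p); apply/eqP; rewrite eq_le powR_ge0 andbT.
apply: (cvgr_to_ge ul); exists n0 => // k /= n0k.
apply: ler_powRl; [exact: ltW|exact: normr_ge0|].
rewrite -(um k n0k); exact: (lp_coord_le (u k - l)).
Qed.

Lemma lp_val_sum (I : Type) (r : seq I) (P : pred I) (u : I -> ell_p hp) m :
  lp_val (\sum_(i <- r | P i) u i) m = \sum_(i <- r | P i) lp_val (u i) m.
Proof. exact: (big_morph (fun u : ell_p hp => lp_val u m)). Qed.

Lemma lp_series_le2 (a : nat -> R^o) (D : R) (j k n : nat) :
  (forall i, i != j -> i != k -> a i = 0) -> (forall i, `|a i| <= D) ->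
  lp_series p a n <= D `^ p + D `^ p.
Proof.
move=> a0 aD; have Dp : 0 <= D `^ p by exact: powR_ge0.
pose t (j i : nat) := if i == j then D `^ p else 0.
have tD l : \sum_(0 <= i < n) t l i <= D `^ p.
  by rewrite -big_mkcond big_nat1_eq; case: ifP.
apply: le_trans (lerD (tD j) (tD k)); rewrite -big_split/=.
apply: ler_sum => i _.
have aip : `|a i| `^ p <= D `^ p.
  by apply: ler_powRl; [exact: ltW|exact: normr_ge0|exact: aD].
rewrite /t; case: eqVneq => [_|ij]; case: eqVneq => [_|ik];
  rewrite ?addr0 ?add0r//.
  by rewrite ler_wpDr.
by rewrite a0// normr0 powR0// gt_eqF.
Qed.

(** Each [f y] has at most one nonzero coordinate, hence each difference has at
    most two and the Lipschitz constants of the bumps do not add up. *)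
Lemma disjoint_bumps_lipschitz (M : Type) (d : M -> M -> R)
    (phi : nat -> M -> R) (L : R) :
  (forall n y z, `|phi n y - phi n z| <= L * d y z) ->
  (forall m n y, phi m y != 0 -> phi n y != 0 -> m = n) ->
  exists2 f : M -> ell_p hp, forall y n, lp_val (f y) n = phi n y
    & Defs.lipschitz d f.
Proof.
move=> phiL phi_disj.
have /choice[j hj] (y : M) : exists j : nat, forall i, i != j -> phi i y = 0.
  (* [j y] is the only bump whose support may contain [y]; 0 is a default. *)
  have [[n n0]|h] := pselect (exists n, phi n y != 0).
    exists n => i; apply: contra_neqP => /eqP i0; exact: phi_disj i0 n0.
  exists 0%N => i _; apply/eqP; rewrite -[_ == _]negbK; apply/negP => i0.
  by apply: h; exists i.
have phi_sum y : (fun n => phi n y : R^o) \in summable_p hp.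
  apply/asboolP.
  apply: (lp_series_cvg (C := `|phi (j y) y| `^ p + `|phi (j y) y| `^ p)).
  move=> n; apply: (@lp_series_le2 _ _ (j y) (j y)) => i.
    by move=> ij _; exact: hj.
  by have [->//|ij] := eqVneq i (j y); rewrite hj// normr0 normr_ge0.
exists (fun y => LpSeq (phi_sum y)) => //.
exists (2 `^ p^-1 * L) => y z; have Ld : 0 <= L * d y z.
  by apply: le_trans (phiL 0%N y z); exact: normr_ge0.
apply: lp_norm_le; first by rewrite -mulrA mulr_ge0 ?powR_ge0.
move=> n; rewrite -mulrA powRM ?powR_ge0// powRVK// mulr_natl mulr2n.
apply: (@lp_series_le2 _ _ (j y) (j z)) => i.
  move=> iy iz /=; rewrite [LHS]/GRing.add/= [X in X + _]hj//.
  by rewrite [X in _ - X]hj// subr0.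
exact: phiL.
Qed.

End SequenceSpaceOperators.

(** * Stars of points with disjoint bumps *)

Section Star.
Context (R : realType) (p : R) (hp : 0 < p <= 1) (M : Type) (d : M -> M -> R).

Definition complemented_lp (N : set M) :=
  forall (o : N) (FM : free_pspace p d (set_val o))
         (FN : free_pspace p (@subdist R M d N) o),
    [/\ isomorphic FN (ell_p hp), isomorphic_embedding (free_incl FN FM)
      & complemented (range (free_incl FN FM))].

(** The hypotheses say that the centre is the (possibly virtual) limit of [c]:
    [c] is Cauchy, all bumps vanish there, and its distance to [x n] is
    at most a multiple of the height [w n] of the bump at [x n]. *)
Lemma star_complemented (N : set M) (phi : nat -> M -> R) (x c : nat -> M)
    (w : nat -> R) (L K : R) :
  (forall n y z, `|phi n y - phi n z| <= L * d y z) ->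
  (forall m n y, phi m y != 0 -> phi n y != 0 -> m = n) ->
  (forall n, 0 < w n) -> (forall n, phi n (x n) = w n) ->
  (forall n, N (x n)) -> (forall k, N (c k)) ->
  (forall y, N y -> (exists n, y = x n) \/ (forall k, c k = y)) ->
  (forall e, 0 < e -> exists n0, forall m n, (n0 <= m <= n)%N ->
     d (c n) (c m) < e) ->
  (forall n, exists n0, forall k, (n0 <= k)%N -> phi n (c k) = 0) ->
  (forall n, exists n0, forall k, (n0 <= k)%N -> d (x n) (c k) <= K * w n) ->
  complemented_lp N.
Proof.
move=> phiL phi_disj w0 phix Nx Nc NE c_cauchy phic xc o FM FN.
have [p0 _] := andP hp.
have [f fE [C fC]] := disjoint_bumps_lipschitz hp phiL phi_disj.
(* The base point [o] is an arbitrary point of N, possibly not the centre. *)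
pose g y := f y - f (set_val o).
have g_lip : Defs.lipschitz d g.
  by exists C => y z; rewrite /g opprB addrA subrK; exact: fC.
have go : g (set_val o) = 0 by rewrite /g subrr.
pose T := free_ext FM g_lip go.
have T_bd : bounded_op T by exact: free_ext_bounded.
pose J := free_incl FN FM.
have J_bd : bounded_op J by exact: free_incl_bounded.
have TJ y : T (J (delta FN y)) = f (set_val y) - f (set_val o).
  by rewrite /J free_inclE free_extE.
have lift (z : nat -> M) : (forall n, N (z n)) ->
    exists zN : nat -> N, forall n, set_val (zN n) = z n.
  by move=> Nz; exists (fun n => SigSub (mem_set (Nz n))).
have [xN xNE] := lift x Nx; have [cN cNE] := lift c Nc.
(* [gam] plays the role of the image of the centre. *)
have [gam hgam] : exists gam, pcvg (fun k => delta FN (cN k)) gam.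
  apply: (pcauchy_cvg hp) => e e0.
  have [n0 hn0] := c_cauchy _ (powR_gt0 p^-1 e0); exists n0 => m n mn.
  rewrite delta_isometric -[ltRHS](powRVK hp (ltW e0)).
  apply: gt0_ltr_powR; rewrite ?nnegrE ?powR_ge0//.
    by rewrite -(delta_isometric FN) pnorm_ge0.
  by rewrite /subdist !cNE hn0.
pose v n := (w n)^-1 *: (delta FN (xN n) - gam).
have v_cvg n : pcvg (fun k => (w n)^-1 *: (delta FN (xN n) - delta FN (cN k)))
    (v n).
  apply: pcvgZ; apply: pcvgD; first by apply: (pcvg_near hp (n0 := 0%N)).
  rewrite -scaleN1r; under eq_fun do rewrite -scaleN1r; exact: pcvgZ.
have v_le n : pnorm (v n) `^ p <= K `^ p.
  have [n0 hn0] := xc n; apply: (pcvg_le (n0 := n0) (v_cvg n)) => k n0k.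
  apply: ler_powRl; [exact: ltW|exact: pnorm_ge0|].
  rewrite pnormZ delta_isometric /subdist xNE cNE.
  rewrite ger0_norm ?invr_ge0 ?(ltW (w0 n))//.
  by rewrite ler_pdivrMl// mulrC hn0.
have [S S_bd hS] := lp_operator hp v_le.
pose U : {linear FN -> ell_p hp} := T \o J.
have U_bd : bounded_op U by exact: bounded_op_comp.
have phi_off m n : m != n -> phi m (x n) = 0.
  move=> mn; apply: contra_neq_eq mn => mx; apply: phi_disj mx _.
  by rewrite phix gt_eqF.
have Uv n m : lp_val (U (v n)) m = (n == m)%:R.
  have [n0 hn0] := phic m.
  apply: (pcvg_coord (n0 := n0) (pcvg_op hp U_bd (v_cvg n))) => k n0k.
  rewrite linearZ linearB/= !TJ xNE cNE opprB addrA subrK.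
  rewrite -[LHS]/((w n)^-1 * (lp_val (f (x n)) m - lp_val (f (c k)) m)).
  rewrite !fE hn0// subr0; have [<-|nm] := eqVneq n m.
    by rewrite phix mulVf// gt_eqF.
  by rewrite phi_off ?mulr0// eq_sym.
have US : cancel S U.
  move=> u; apply/val_inj/funext => m.
  apply: (pcvg_coord (n0 := m.+1) (pcvg_op hp U_bd (hS u))) => k mk.
  have UZ i : lp_val (U ((lp_val u i : R) *: v i)) m = lp_val u i * (i == m)%:R.
    by rewrite linearZ -Uv.
  rewrite linear_sum lp_val_sum (bigD1 (Ordinal mk))//= UZ eqxx mulr1.
  rewrite big1 ?addr0// => i im.
  by rewrite UZ (negbTE im : (i == m :> nat) = _) mulr0.
have Sf (y : N) : S (f (set_val y)) = delta FN y - gam.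
  have [[n yn]|yc] := NE _ (set_valP y).
    have -> : y = xN n by apply/val_inj; exact: (etrans yn (esym (xNE n))).
    rewrite xNE; apply: (pcvg_unique (hS _)).
    apply: (pcvg_near hp (n0 := n.+1)) => k nk.
    rewrite (bigD1 (Ordinal nk))//= fE phix /v scalerA mulfV ?gt_eqF// scale1r.
    rewrite big1 ?addr0// => i ni; rewrite fE phi_off ?scale0r//.
  have -> : delta FN y = gam.
    apply: (pcvg_unique _ hgam); apply: (pcvg_near hp (n0 := 0%N)) => k _.
    by congr delta; apply/val_inj; exact: (etrans (cNE k) (yc k)).
  rewrite subrr; apply: (pcvg_unique (hS _)).
  apply: (pcvg_near hp (n0 := 0%N)) => k _; rewrite big1// => i _.
  have [n0 hn0] := phic i; have yE : c n0 = set_val y := yc n0.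
  by rewrite fE -yE hn0// scale0r.
have dN_lip : Defs.lipschitz (@subdist _ _ d N) (delta FN).
  by exists 1 => y z; rewrite mul1r delta_isometric.
(* A bounded operator of F_p(N) that fixes the points of N is the identity. *)
have SU : cancel U S.
  have idE := free_ext_unique dN_lip (delta_base FN)
    (T := idfun : {linear FN -> FN}).
  have SUE := free_ext_unique dN_lip (delta_base FN)
    (T := S \o U : {linear FN -> FN}).
  move=> y; rewrite -[LHS]/((S \o U) y) SUE -?idE//.
  - by exists 1 => z; rewrite mul1r.
  - exact: bounded_op_comp.
  - move=> z /=; rewrite TJ linearB/= !Sf opprB addrA subrK.
    by rewrite delta_base subr0.
split.
- by exists U, S.
- split=> //.
    apply: (@can_inj _ _ J (S \o T)); exact: SU.
  have [B hB] := bounded_op_comp S_bd T_bd.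
  by exists B => y; rewrite -[in leLHS](SU y); exact: hB.
- exists (J \o S \o T : {linear FM -> FM}); split.
  + by do 2!apply: bounded_op_comp => //.
  + by move=> y /=; rewrite [S (T (J _))]SU.
  + apply/seteqP; split=> _ [y _ <-]; first by exists (S (T y)).
    by exists (J y) => //=; rewrite [S (T (J _))]SU.
Qed.

End Star.

(** * Stars in infinite metric spaces *)

Section Selection.
Context (M : Type).

(** Dependent choice on infinite sets: all later points lie in the set selected
    together with [x n], so that a condition of [x n] on the set [A n.+1] is a
    condition on all pairs of points. *)
Lemma nested_selection (A0 : set M) (P : M -> set M -> Prop) :
  infinite_set A0 ->
  (forall A, A `<=` A0 -> infinite_set A ->
     exists t A', [/\ A t, A' `<=` A, infinite_set A' & P t A']) ->
  exists (x : nat -> M) (A : nat -> set M),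
    [/\ forall n, A n `<=` A0, forall n, infinite_set (A n),
        forall n, P (x n) (A n.+1)
      & forall m n, (m <= n)%N -> A m (x n)].
Proof.
move=> A0inf step.
pose st := {A : set M | A `<=` A0 /\ infinite_set A}.
have /choice[nxt hnxt] (a : st) : exists b : M * st,
    [/\ sval a b.1, sval b.2 `<=` sval a & P b.1 (sval b.2)].
  case: a => A [AA0 Ainf] /=.
  have [t [A' [At A'A A'inf PA']]] := step A AA0 Ainf.
  by exists (t, exist _ A' (conj (subset_trans A'A AA0) A'inf)).
pose a n := iter n (fun b => (nxt b).2)
  (exist _ A0 (conj (@subset_refl _ A0) A0inf)).
have aS m n : (m <= n)%N -> sval (a n) `<=` sval (a m).
  move=> /subnK <-; elim: (n - m)%N => [//|k IH]; rewrite addSn.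
  by apply: subset_trans IH; have [] := hnxt (a (k + m)%N).
exists (fun n => (nxt (a n)).1), (fun n => sval (a n)); split.
- by move=> n; have [] := svalP (a n).
- by move=> n; have [] := svalP (a n).
- by move=> n; have [] := hnxt (a n).
- by move=> m n /aS; apply; have [] := hnxt (a n).
Qed.

Lemma infinite_set_two (A : set M) : infinite_set A ->
  exists y z, [/\ A y, A z & y <> z].
Proof.
move=> Ainf; have [y Ay] := infinite_setN0 Ainf.
have [z [Az zy]] := infinite_setN0 (infinite_setD Ainf (finite_set1 y)).
by exists y, z; split=> // yz; apply: zy.
Qed.

End Selection.

Section MetricStars.
Context (R : realType) (p : R) (hp : 0 < p <= 1) (M : Type) (d : M -> M -> R).

Context (dM : is_metric d).

Let d0 := is_metric_ge0 dM.
Let dC := is_metric_sym dM.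
Let dT := is_metric_tri dM.
Let dxx x : d x x = 0. Proof. by apply/(is_metric_eq0 dM). Qed.

(** The bumps are truncated cones; the condition on [w m + w n] makes the balls
    of centre [x n] and radius [w n] disjoint. *)
Lemma metric_star_complemented (N : set M) (x c : nat -> M) (w : nat -> R)
    (K : R) :
  (forall n, 0 < w n) ->
  (forall m n, (m < n)%N -> w m + w n <= d (x m) (x n)) ->
  (forall n, N (x n)) -> (forall k, N (c k)) ->
  (forall y, N y -> (exists n, y = x n) \/ (forall k, c k = y)) ->
  (forall e, 0 < e -> exists n0, forall m n, (n0 <= m <= n)%N ->
     d (c n) (c m) < e) ->
  (forall n, exists n0, forall k, (n0 <= k)%N ->
     w n <= d (x n) (c k) <= K * w n) ->
  complemented_lp hp d N.
Proof.
move=> w0 wx Nx Nc NE c_cauchy xc.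
pose phi n y := Num.max 0 (w n - d (x n) y).
apply: (@star_complemented _ p hp M d N phi x c w 1 K) => //.
- move=> n y z; rewrite mul1r /phi.
  have h1 := dT (x n) y z; have h2 := dT (x n) z y.
  rewrite (dC z y) in h1.
  have dyz := d0 y z.
  rewrite ler_norml; case: (leP 0 (w n - d (x n) y)) => ?;
    case: (leP 0 (w n - d (x n) z)) => ?; apply/andP; split; lra.
- move=> m n y.
  have phi_gt k : phi k y != 0 -> d (x k) y < w k.
    rewrite /phi.
    case: (leP 0 (w k - d (x k) y)) => [h nz|_]; last by rewrite eqxx.
    by rewrite -subr_gt0 lt_neqAle eq_sym nz h.
  wlog mn : m n / (m < n)%N => [wl hm hn|/phi_gt hm /phi_gt hn].
    have [mn|nm|//] := ltngtP m n; first exact: wl.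
    by apply/esym/wl.
  exfalso; have := wx _ _ mn; have := dT (x m) (x n) y.
  by rewrite (dC y (x n)); lra.
- by move=> n; rewrite /phi dxx subr0 max_r// ltW.
- move=> n; have [n0 hn0] := xc n; exists n0 => k /hn0/andP[h _].
  by rewrite /phi max_l// subr_le0.
- by move=> n; have [n0 hn0] := xc n; exists n0 => k /hn0/andP[].
Qed.

(** A set of small diameter cannot be near two given points, so one of them is
    far from the set in comparison with its diameter.  Iterating this yields a
    sequence whose distances [d (x m) (x n)], [m < n], are comparable to a
    [w m] that decays geometrically: the sequence is Cauchy and is the star
    around its own limit. *)
Lemma shrinking_lp :
  infinite_set [set: M] ->
  (forall (A : set M) e, infinite_set A -> 0 < e ->
     exists B, [/\ B `<=` A, infinite_set B
       & forall y z, B y -> B z -> d y z <= e]) ->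
  exists N : set M, N !=set0 /\ complemented_lp hp d N.
Proof.
move=> Minf shrink.
pose P (t : M) (B : set M) := exists w : R, [/\ 0 < w,
  forall z, B z -> 2 * w <= d t z <= 4 * w
  & forall y z, B y -> B z -> d y z <= w].
have [A _ Ainf|x [A [_ Ainf PA Ax]]] := @nested_selection M setT P Minf.
  have [y [y' [Ay Ay' yy']]] := infinite_set_two Ainf.
  have dyy' : 0 < d y y'.
    rewrite lt_neqAle d0 andbT eq_sym; apply/eqP => /(is_metric_eq0 dM).
    exact: yy'.
  have [|B [BA Binf Bd]] := shrink A (d y y' / 6) Ainf; first lra.
  have [z0 Bz0] := infinite_setN0 Binf.
  have [t [At tz0]] : exists t, A t /\ d y y' / 2 <= d t z0.
    have := dT y y' z0; rewrite (dC z0 y') => h.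
    have [h'|h'] := leP (d y y' / 2) (d y z0); first by exists y.
    by exists y'; split => //; lra.
  (* The diameter of B is at most a third of [d t z0]. *)
  exists t, B; split => //; exists (d t z0 / 3); split.
  - lra.
  - move=> z Bz; have := Bd z0 z Bz0 Bz.
    have := dT t z z0; have := dT t z0 z; rewrite (dC z z0).
    by move=> *; apply/andP; split; lra.
  - by move=> z z' Bz Bz'; have := Bd z z' Bz Bz'; lra.
have [w hw] := choice PA.
have w0 n : 0 < w n by have [] := hw n.
have dxx' m n : (m < n)%N -> 2 * w m <= d (x m) (x n) <= 4 * w m.
  by move=> mn; have [_ h _] := hw m; exact/h/Ax.
have dtail l m n : (l < m)%N -> (l < n)%N -> d (x m) (x n) <= w l.
  by move=> lm ln; have [_ _ h] := hw l; apply: h; exact: Ax.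
have wS m n : (m < n)%N -> 2 * w n <= w m.
  move=> mn; have /andP[h _] := dxx' n n.+1 (ltnSn n); apply: le_trans h _.
  by apply: dtail => //; exact: ltnW.
have wn n : w n * n.+1%:R <= w 0%N.
  elim: n => [|n]; first by rewrite mulr1.
  apply: le_trans; have := wS n n.+1 (ltnSn n); have := w0 n.+1.
  have := ler0n R n; rewrite -!natr1; nra.
exists (range x); split; first by exists (x 0%N); exists 0%N.
apply: (@metric_star_complemented _ x x w 4) => //.
- move=> m n mn; have := wS m n mn; have := dxx' m n mn; have := w0 n.
  by move=> ? /andP[? _] ?; lra.
- by move=> _ [n _ <-]; left; exists n.
- move=> e e0; have we0 : 0 <= w 0%N / e by rewrite divr_ge0// ltW.
  pose n0 := Num.bound (w 0%N / e).
  have wn0 : w n0 < e.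
    have := archi_boundP we0; rewrite ltr_pdivrMr// -/n0 => h.
    rewrite -(ltr_pM2r (ltr0Sn R n0)); apply: le_lt_trans (wn n0) _.
    apply: lt_le_trans h _; rewrite mulrC ler_pM2l// ler_nat//.
  exists n0.+1 => m n /andP[n0m mn]; apply: le_lt_trans wn0.
  by apply: dtail => //; exact: leq_trans mn.
- move=> n; exists n.+1 => k /dxx'/andP[h ->]; rewrite andbT.
  by apply: le_trans h; have := w0 n; lra.
Qed.

(** Each selected point excludes only finitely many later ones. *)
Lemma fixed_centre_lp (A0 : set M) (c : M) (u : M -> R) (K : R) :
  infinite_set A0 -> (forall z, A0 z -> 0 < u z) ->
  (forall z, A0 z -> u z <= d z c <= K * u z) ->
  (forall t, A0 t -> finite_set (A0 `&` [set z | d t z < u t + u z])) ->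
  exists N : set M, N !=set0 /\ complemented_lp hp d N.
Proof.
move=> A0inf u0 uc near_fin.
pose P (t : M) (B : set M) := forall z, B z -> u t + u z <= d t z.
have [A AA0 Ainf|x [A [AA0 _ PA Ax]]] := @nested_selection M A0 P A0inf.
  have [t At] := infinite_setN0 Ainf.
  exists t, (A `\` (A0 `&` [set z | d t z < u t + u z])); split => //.
  - exact: infinite_setD Ainf (near_fin t (AA0 t At)).
  - move=> z [Az h]; rewrite leNgt; apply/negP => h'.
    by apply: h; split => //; exact: AA0.
have A0x n : A0 (x n) by apply: (AA0 0%N); exact: Ax.
exists [set y | y = c \/ exists n, y = x n]; split; first by exists c; left.
apply: (@metric_star_complemented _ x (fun=> c) (u \o x) K) => //=.
- by move=> n; exact: u0.
- by move=> m n mn; apply: PA; exact: Ax.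
- by move=> n; right; exists n.
- by left.
- by move=> y [->|]; [right|left].
- by move=> e e0; exists 0%N => m n _; rewrite dxx.
- by move=> n; exists 0%N => k _; exact: uc.
Qed.

Lemma metric_lp : infinite_set [set: M] ->
  exists N : set M, N !=set0 /\ complemented_lp hp d N.
Proof.
move=> Minf.
have [|nshrink] := pselect (forall (A : set M) e, infinite_set A -> 0 < e ->
     exists B, [/\ B `<=` A, infinite_set B
       & forall y z, B y -> B z -> d y z <= e]); first exact: shrinking_lp.
have [A [e [Ainf e0 Ash]]] : exists A e, [/\ infinite_set A, 0 < e &
    forall B, B `<=` A -> infinite_set B ->
      ~ forall y z, B y -> B z -> d y z <= e].
  apply: contrapT => h; apply: nshrink => A e Ainf e0; apply: contrapT => hB.
  by apply: h; exists A, e; split => // B BA Binf Bd; apply: hB; exists B.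
have ball_fin t : finite_set (A `&` [set z | d t z < e / 2]).
  apply: contrapT => /Ash; apply; first exact: subIsetl.
  move=> y z [_ /= ty] [_ /= tz]; have := dT y z t; rewrite (dC y t); lra.
have [[c [r Acr]]|ball_fin'] := pselect (exists c r,
    infinite_set (A `&` [set z | d z c <= r])).
  apply: (@fixed_centre_lp ((A `&` [set z | d z c <= r]) `\`
    (A `&` [set z | d c z < e / 2])) c (fun=> e / 4) (4 * r / e)).
  - exact: infinite_setD.
  - by move=> z _; lra.
  - move=> z [[Az /= zr] zc]; apply/andP; split.
      rewrite dC; apply: contrapT => h; apply: zc; split => //=.
      by move/negP: h; rewrite -ltNge; lra.
    by have -> : 4 * r / e * (e / 4) = r by field; rewrite gt_eqF.
  - move=> t _; apply: sub_finite_set (ball_fin t) => z [[[Az _] _] /= h].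
    by split=> //=; lra.
have ball_fin2 c r : finite_set (A `&` [set z | d z c <= r]).
  by apply: contrapT => h; apply: ball_fin'; exists c, r.
have [c Ac] := infinite_setN0 Ainf.
apply: (@fixed_centre_lp (A `\` (A `&` [set z | d z c <= 0])) c
  (fun z => d z c / 4) 4).
- exact: infinite_setD.
- move=> z [Az zc]; have : 0 < d z c; last lra.
  by rewrite ltNge; apply/negP => h; exact: zc.
- by move=> z _; have := d0 z c => ?; apply/andP; split; lra.
- (* [d t z < d t c / 4 + d z c / 4] forces [d z c <= 5 / 3 * d t c]. *)
  move=> t _; apply: sub_finite_set (ball_fin2 c (2 * d t c)).
  move=> z [[Az _] /= h]; split => //=.
  by have := dT z c t; rewrite (dC z t); have := d0 t c; lra.
Qed.

End MetricStars.

(** * Stars in uniformly separated spaces *)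

Section SeparatedStars.
Context (R : realType) (p : R) (hp : 0 < p <= 1) (M : Type) (d : M -> M -> R).

Lemma uniformly_separatedP : uniformly_separated d ->
  exists2 e, 0 < e & forall x y, x <> y -> e <= d x y.
Proof.
rewrite /uniformly_separated; set D := [set r | _] => D0.
have Dle x y : x <> y -> (ereal_inf D <= (d x y)%:E)%E.
  by move=> xy; apply: ereal_inf_lbound; exists x, y.
case: (ereal_inf D) D0 Dle => [e|_|//].
  by rewrite lte_fin => e0 h; exists e => // x y /h; rewrite lee_fin.
by move=> h; exists 1 => // x y /h; rewrite leNgt ltry.
Qed.

Lemma uncountable_ball (c : M) : ~ countable [set: M] ->
  exists r, infinite_set [set y | d y c <= r].
Proof.
move=> Munc; apply: contrapT => h; apply: Munc.
have -> : [set: M] = \bigcup_(n in [set: nat]) [set y | d y c <= n%:R].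
  apply/seteqP; split => // y _; exists (Num.bound (d y c)) => //=.
  apply: le_trans (ler_norm _) _; rewrite ltW//.
  by have := archi_boundP (normr_ge0 (d y c)); rewrite /Num.bound normr_id.
apply: bigcup_countable => // n _; apply: finite_set_countable.
by apply: contrapT => hn; apply: h; exists n%:R.
Qed.

Lemma separated_lp : is_pmetric p d -> uniformly_separated d ->
  ~ countable [set: M] -> exists N : set M, N !=set0 /\ complemented_lp hp d N.
Proof.
move=> dM /uniformly_separatedP[e e0 de] Munc.
have d0 := is_pmetric_ge0 dM.
have [c _] : [set: M] !=set0.
  by apply/set0P/eqP => h; apply: Munc; rewrite h.
have [r Br] := uncountable_ball c Munc.
pose A0 := [set y | d y c <= r] `\ c.
have [A AA0 Ainf|x [A [AA0 _ PA Ax]]] :=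
    @nested_selection M A0 (fun t B => ~ B t)
      (infinite_setD Br (finite_set1 c)).
  have [t At] := infinite_setN0 Ainf.
  exists t, (A `\ t); split => //; last by move=> [_]; apply.
  exact: infinite_setD Ainf (finite_set1 t).
have A0x n : A0 (x n) by apply: (AA0 0%N); exact: Ax.
have xI m n : x m = x n -> m = n.
  have lt k l : (k < l)%N -> x k <> x l.
    by move=> kl E; apply: (PA k); rewrite E; exact: Ax.
  by have [/lt //|/lt h /esym /h|] := ltngtP m n.
pose phi n y : R := (`[< y = x n >])%:R.
exists [set y | y = c \/ exists n, y = x n]; split; first by exists c; left.
apply: (@star_complemented _ p hp M d _ phi x (fun=> c) (fun=> 1) e^-1 r) => //=.
- move=> n y z; have [->|yz] := pselect (y = z).
    by rewrite subrr normr0 mulr_ge0// invr_ge0 ltW.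
  apply: (@le_trans _ _ 1); last by rewrite ler_pdivlMl// mulr1 de.
  rewrite /phi; do 2!case: asboolP => _ /=;
    by rewrite ?subrr ?subr0 ?sub0r ?normrN ?normr0 ?normr1.
- move=> m n y; rewrite /phi !pnatr_eq0 !eqb0 !negbK => /asboolP ym /asboolP yn.
  by apply: xI; rewrite -ym.
- by move=> n; rewrite /phi; case: asboolP.
- by move=> n; right; exists n.
- by left.
- by move=> y [->|]; [right|left].
- by move=> e' e'0; exists 0%N => m n _; rewrite (is_pmetric_eq0 dM c c).2.
- move=> n; exists 0%N => k _; rewrite /phi; case: asboolP => // cx.
  by case: (A0x n) => _; case.
- by move=> n; exists 0%N => k _; rewrite mulr1; case: (A0x n).
Qed.

End SeparatedStars.

Theorem theorem2p2 (R : realType) (p : R) (hp : 0 < p <= 1) (M : Type)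
    (d : M -> M -> R)
    (hM : (is_metric d /\ infinite_set [set: M]) \/
          (is_pmetric p d /\ uniformly_separated d /\ ~ countable [set: M])) :
  exists N : set M, N !=set0 /\
    forall (o : N) (FM : free_pspace p d (set_val o))
           (FN : free_pspace p (@subdist R M d N) o),
      [/\ isomorphic FN (ell_p hp),
          isomorphic_embedding (free_incl FN FM)
        & complemented (range (free_incl FN FM))].
Proof.
case: hM => [[dM Minf]|[dM [dsep Munc]]].
  exact: (metric_lp hp dM Minf).
exact: (separated_lp hp dM dsep Munc).
Qed.
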